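(* Let $F\colon\mathcal{C}\to\mathcal{E}$ be a functor, let $\tau$ be the terminal category, and let $K\colon\mathcal{C}\to\tau$ be the only functor from $\mathcal{C}$ to $\tau$. The colimit of $F$ exists if, and only if, the (left) Kan extension of $F$ along $K$ exists.
   Context: All categories are locally small. The terminal category $\tau$ has exactly one object $\ast$ and exactly one morphism, the identity of $\ast$. Given functors $F\colon\mathcal{C}\to\mathcal{E}$ and $K\colon\mathcal{C}\to\mathcal{D}$, a (left) Kan extension of $F$ along $K$ is a functor $G\colon\mathcal{D}\to\mathcal{E}$ together with a natural transformation $\eta\colon F\Rightarrow G\circ K$ such that for any other pair $(G'\colon\mathcal{D}\to\mathcal{E},\ \eta'\colon F\Rightarrow G'\circ K)$ there is a unique natural transformation $\alpha\colon G\Rightarrow G'$ with $\eta'=\alpha_K\circ\eta$, where $(\alpha_K)_C=\alpha_{K(C)}$. *)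

(* Defs.v *)
From Stdlib Require Import FunctionalExtensionality ProofIrrelevance.

Set Implicit Arguments.
Unset Strict Implicit.

Declare Scope cat_scope.
Delimit Scope cat_scope with cat.
Local Open Scope cat_scope.

(* Local smallness is typing: every [Hom a b] is a type in one fixed universe,
   which is independent of the universe of the class of objects [Ob]. *)
Record category := Category {
  Ob :> Type;
  Hom : Ob -> Ob -> Type;
  id : forall a, Hom a a;
  comp : forall a b c, Hom b c -> Hom a b -> Hom a c;
  comp_id_l : forall a b (f : Hom a b), comp (id b) f = f;
  comp_id_r : forall a b (f : Hom a b), comp f (id a) = f;
  comp_assoc : forall a b c d (h : Hom c d) (g : Hom b c) (f : Hom a b),
    comp h (comp g f) = comp (comp h g) f
}.

Notation "g ∘ f" := (comp g f) (at level 40, left associativity) : cat_scope.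

Record functor (C D : category) := Functor {
  fobj :> C -> D;
  fmap : forall a b : C, Hom a b -> Hom (fobj a) (fobj b);
  fmap_id : forall a : C, fmap (id a) = id (fobj a);
  fmap_comp : forall (a b c : C) (g : Hom b c) (f : Hom a b),
    fmap (g ∘ f) = fmap g ∘ fmap f
}.

Program Definition fcomp (C D E : category) (G : functor D E) (K : functor C D) :
    functor C E :=
  {| fobj := fun c => G (K c);
     fmap := fun a b f => fmap G (fmap K f) |}.
Next Obligation. intros; cbn; now rewrite !fmap_id. Qed.
Next Obligation. intros; cbn; now rewrite !fmap_comp. Qed.

Record nat_trans (C D : category) (F G : functor C D) := NatTrans {
  component :> forall c : C, Hom (F c) (G c);
  naturality : forall (a b : C) (f : Hom a b),
    component b ∘ fmap F f = fmap G f ∘ component a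
}.

Program Definition vcomp (C D : category) (F G H : functor C D)
    (beta : nat_trans G H) (alpha : nat_trans F G) : nat_trans F H :=
  {| component := fun c => beta c ∘ alpha c |}.
Next Obligation.
intros; cbn; now rewrite <- comp_assoc, naturality, !comp_assoc, naturality.
Qed.

(* [whisker alpha K] is the transformation alpha_K : G ∘ K => G' ∘ K. *)
Program Definition whisker (C D E : category) (G G' : functor D E)
    (alpha : nat_trans G G') (K : functor C D) :
    nat_trans (fcomp G K) (fcomp G' K) :=
  {| component := fun c => alpha (K c) |}.
Next Obligation. intros; cbn; apply naturality. Qed.

Definition is_left_kan_extension (C D E : category)
    (F : functor C E) (K : functor C D)
    (G : functor D E) (eta : nat_trans F (fcomp G K)) : Prop :=
  forall (G' : functor D E) (eta' : nat_trans F (fcomp G' K)),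
    exists! alpha : nat_trans G G', eta' = vcomp (whisker alpha K) eta.

Definition left_kan_extension_exists (C D E : category)
    (F : functor C E) (K : functor C D) : Prop :=
  exists (G : functor D E) (eta : nat_trans F (fcomp G K)),
    is_left_kan_extension eta.

Record cocone (C E : category) (F : functor C E) := Cocone {
  apex : E;
  leg : forall c : C, Hom (F c) apex;
  leg_fmap : forall (a b : C) (f : Hom a b), leg b ∘ fmap F f = leg a
}.

Definition is_colimit (C E : category) (F : functor C E) (L : cocone F) : Prop :=
  forall M : cocone F,
    exists! u : Hom (apex L) (apex M), forall c : C, u ∘ leg L c = leg M c.

Definition colimit_exists (C E : category) (F : functor C E) : Prop :=
  exists L : cocone F, is_colimit L.

Program Definition terminal_category : category :=
  {| Ob := unit;
     Hom := fun _ _ => unit;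
     id := fun _ => tt;
     comp := fun _ _ _ _ _ => tt |}.
Next Obligation. intros; now destruct f. Qed.
Next Obligation. intros; now destruct f. Qed.
Next Obligation. reflexivity. Qed.

Program Definition to_terminal (C : category) : functor C terminal_category :=
  {| fobj := fun _ => tt;
     fmap := fun _ _ _ => tt |}.
Next Obligation. reflexivity. Qed.
Next Obligation. reflexivity. Qed.

Lemma to_terminal_unique (C : category) (K : functor C terminal_category) :
  K = to_terminal C.
Proof.
destruct K as [o m mid mcomp]; simpl in *.
assert (o = fun _ => tt) as ->
  by (apply functional_extensionality; intro c; now destruct (o c)).
assert (m = fun _ _ _ => tt) as ->
  by (do 3 (apply functional_extensionality_dep; intro);
      match goal with |- ?x = tt => now destruct x end).
unfold to_terminal; f_equal; apply proof_irrelevance.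
Qed.

(* Main.v *)
From Stdlib Require Import FunctionalExtensionality ProofIrrelevance.
Require Import Defs.

Set Implicit Arguments.
Unset Strict Implicit.
Local Open Scope cat_scope.

(** A functor [G] out of the terminal category is determined by the object
    [G tt], and a transformation between two such functors by its single
    component, any morphism being allowed there, because functors send the
    only morphism of the terminal category to an identity.  Under this
    dictionary a transformation [F => G ∘ K] is exactly a cocone under [F] with
    apex [G tt]: its naturality squares degenerate to the cocone triangles.  A
    factorization [eta' = alpha_K ∘ eta] is likewise exactly a morphism of
    apexes compatible with the legs.  So the two universal properties, each
    quantified over all competitors, are the same ([left_kan_iff_colimit]).
    The theorem follows because every cocone arises from some pair [(G, eta)],
    with [G] constant at the apex ([cocone_of_transK]). *)

Lemma nat_trans_ext (C D : category) (F G : functor C D)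
    (alpha beta : nat_trans F G) :
  (forall c, alpha c = beta c) -> alpha = beta.
Proof.
destruct alpha as [a na], beta as [b nb]; cbn; intro e.
assert (a = b) as -> by now apply functional_extensionality_dep.
f_equal; apply proof_irrelevance.
Qed.

Lemma fmap_terminal (E : category) (G : functor terminal_category E)
    (f : Hom (tt : terminal_category) tt) :
  fmap G f = id (G tt).
Proof. destruct f; exact (fmap_id G tt). Qed.

Program Definition const_functor (E : category) (e : E) :
    functor terminal_category E :=
  {| fobj := fun _ => e;
     fmap := fun _ _ _ => id e |}.
Next Obligation. reflexivity. Qed.
Next Obligation. intros; cbn; now rewrite comp_id_l. Qed.

Program Definition point_trans (E : category)
    (G G' : functor terminal_category E) (u : Hom (G tt) (G' tt)) :
    nat_trans G G' :=
  {| component := fun x : terminal_category =>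
       match x return Hom (G x) (G' x) with tt => u end |}.
Next Obligation.
intros E G G' u [] [] f.
now rewrite !fmap_terminal, comp_id_l, comp_id_r.
Qed.

Program Definition cocone_of_trans (C E : category) (F : functor C E)
    (G : functor terminal_category E)
    (eta : nat_trans F (fcomp G (to_terminal C))) : cocone F :=
  {| apex := G tt; leg := fun c => eta c |}.
Next Obligation.
intros C E F G eta a b f.
pose proof (naturality eta f) as nat; cbn in nat.
rewrite fmap_terminal, comp_id_l in nat; exact nat.
Qed.

Program Definition trans_of_cocone (C E : category) (F : functor C E)
    (L : cocone F) :
    nat_trans F (fcomp (const_functor (apex L)) (to_terminal C)) :=
  {| component := fun c => leg L c |}.
Next Obligation. intros; cbn; now rewrite leg_fmap, comp_id_l. Qed.

Lemma cocone_of_transK (C E : category) (F : functor C E) (L : cocone F) :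
  cocone_of_trans (trans_of_cocone L) = L.
Proof.
destruct L as [e l nl]; unfold cocone_of_trans; cbn.
f_equal; apply proof_irrelevance.
Qed.

Lemma factorization_iff (C E : category) (F : functor C E)
    (G G' : functor terminal_category E)
    (eta : nat_trans F (fcomp G (to_terminal C)))
    (eta' : nat_trans F (fcomp G' (to_terminal C))) (alpha : nat_trans G G') :
  eta' = vcomp (whisker alpha (to_terminal C)) eta <->
  forall c, alpha tt ∘ eta c = eta' c.
Proof.
split.
- intros -> c; reflexivity.
- intro e; apply nat_trans_ext; intro c; symmetry; exact (e c).
Qed.

(** The competitors match on both sides: a pair [(G', eta')] is tested against
    the cocone it defines, and a cocone [M] against the constant functor at its
    apex; [point_trans] and evaluation at [tt] exchange the mediating
    morphisms. *)
Lemma left_kan_iff_colimit (C E : category) (F : functor C E)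
    (G : functor terminal_category E)
    (eta : nat_trans F (fcomp G (to_terminal C))) :
  is_left_kan_extension eta <-> is_colimit (cocone_of_trans eta).
Proof.
split.
- intros kan M.
  destruct (kan _ (trans_of_cocone M)) as [alpha [fact uniq]].
  exists (alpha tt); split.
  + exact (proj1 (factorization_iff _ _ _) fact).
  + intros u fact_u.
    rewrite (uniq (point_trans (G' := const_functor (apex M)) u)).
    * reflexivity.
    * now apply factorization_iff.
- intros colim G' eta'.
  destruct (colim (cocone_of_trans eta')) as [u [fact uniq]].
  exists (point_trans u); split.
  + now apply factorization_iff.
  + intros alpha fact_alpha.
    apply nat_trans_ext; intros [].
    apply uniq; exact (proj1 (factorization_iff _ _ _) fact_alpha).
Qed.

Theorem proposition1p2 (C E : category) (F : functor C E) :
  colimit_exists F <-> left_kan_extension_exists F (to_terminal C).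
Proof.
split.
- intros [L colim].
  exists (const_functor (apex L)), (trans_of_cocone L).
  apply left_kan_iff_colimit; now rewrite cocone_of_transK.
- intros [G [eta kan]].
  exists (cocone_of_trans eta); now apply left_kan_iff_colimit.
Qed.
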